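(* Let $(\mathcal{G},S_m)$ be a graph of groups on the star graph $S_m$ with a free abelian group of finite rank associated to the central vertex, finitely generated right-angled Artin groups associated to the external vertices, and cyclic edge groups. For each edge $e_i$, $i=1,\dots,m$, let $k_i$ be a generator of the edge group $G_{e_i}$, and let $\alpha_{e_i}$ and $\omega_{e_i}$ be the monomorphisms of $G_{e_i}$ into the central vertex group and the corresponding external vertex group respectively. Assume that for all $i=1,\dots,m$ the element $\omega_{e_i}(k_i)$ is a generator of the external vertex group (or can be extended to a new RAAG generating set of it). Then the fundamental group $G=\pi_1(\mathcal{G},S_m)$ is $\mathbb{Z}$-linear.
   Context: The star graph $S_m$ is the tree with one central vertex joined by edges $e_1,\dots,e_m$ to $m$ external vertices (leaves); each $e_i$ is oriented from the central vertex to the leaf. If $K_0$ is the central vertex group and $K_1,\dots,K_m$ are the external vertex groups, $\pi_1(\mathcal{G},S_m)$ is the quotient of the free product $K_0*K_1*\cdots*K_m$ by the relations $\alpha_{e_i}(g)=\omega_{e_i}(g)$ for $g\in G_{e_i}$, $i=1,\dots,m$. A RAAG generating set of a right-angled Artin group $K$ is a generating set $S$ such that $K$ has a presentation $\langle S\mid R\rangle$ in which every relator in $R$ is a commutator of two elements of $S$; ''generator'' means an element of the standard RAAG generating set. A group is $\mathbb{Z}$-linear if it admits a faithful representation into $GL_n(\mathbb{Z})$ for some $n$. *)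

(* Defs.v *)
From HB Require Import structures.
From mathcomp Require Import all_boot all_order all_algebra.
From mathcomp Require Import mathcomp_extra boolp classical_sets cardinality.

Set Implicit Arguments.
Unset Strict Implicit.
Unset Printing Implicit Defensive.

Import GRing.Theory.

Local Open Scope classical_set_scope.
Local Open Scope quotient_scope.
Local Open Scope group_scope.

(* Groups are MathComp's [groupType] (possibly infinite, written
   multiplicatively); subsets are classical sets. *)

Definition generated (G : groupType) (A : set G) : set G :=
  smallest [set H : set G | group_closed (mem H)] A.

Definition normal_closure (G : groupType) (A : set G) : set G :=
  smallest [set N : set G | group_closed (mem N) /\
                            forall x y : G, N x -> N (x ^ y)] A.

Definition finitely_generated (G : groupType) : Prop :=
  exists A : set G, finite_set A /\ generated A = [set: G].

Definition free_abelian_of_finite_rank (G : groupType) : Prop :=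
  exists (n : nat) (f : G -> 'rV[int]_n),
    bijective f /\ forall x y : G, f (x * y) = (f x + f y)%R.

Definition Z_linear (G : groupType) : Prop :=
  exists (n : nat) (rho : G -> 'M[int]_n),
    [/\ forall x : G, rho x \in unitmx,
        forall x y : G, rho (x * y) = (rho x *m rho y)%R
      & injective rho].

(* [group_mod R] is G / <<R>>, the quotient of G by the relators in R. *)

Section GroupMod.
Variables (G : groupType) (R : set G).

Lemma normal_closure1 : normal_closure R 1.
Proof. by move=> N [[[N1 _] _] _]; rewrite !inE in N1. Qed.

Lemma normal_closureF x y :
  normal_closure R x -> normal_closure R y -> normal_closure R (x / y).
Proof.
move=> Rx Ry N NR; have [[[_ NF] _] _] := NR.
by have := NF x y; rewrite !inE; apply; [exact: Rx | exact: Ry].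
Qed.

Lemma normal_closureV x : normal_closure R x -> normal_closure R x^-1.
Proof. by move=> Rx; rewrite -[_^-1]mul1g; exact: normal_closureF normal_closure1 Rx. Qed.

Lemma normal_closureM x y :
  normal_closure R x -> normal_closure R y -> normal_closure R (x * y).
Proof.
by move=> Rx Ry; rewrite -[y]invgK; exact: normal_closureF Rx (normal_closureV Ry).
Qed.

Lemma normal_closureJ x y : normal_closure R x -> normal_closure R (x ^ y).
Proof. by move=> Rx N NR; have [[_ NJ] _] := NR; apply: NJ; exact: Rx. Qed.

Definition gmod_rel : rel G := fun x y => `[< normal_closure R (x^-1 * y) >].

Lemma gmod_refl : reflexive gmod_rel.
Proof. by move=> x; apply/asboolP; rewrite mulVg; exact: normal_closure1. Qed.

Lemma gmod_sym : symmetric gmod_rel.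
Proof.
by move=> x y; apply/asboolP/asboolP => /normal_closureV; rewrite invgM invgK.
Qed.

Lemma gmod_trans : transitive gmod_rel.
Proof.
move=> y x z /asboolP xy /asboolP yz; apply/asboolP.
by have := normal_closureM xy yz; rewrite mulgA mulgK.
Qed.

Canonical gmod_equiv := EquivRel gmod_rel gmod_refl gmod_sym gmod_trans.

Definition group_mod : Type := {eq_quot gmod_rel}.
HB.instance Definition _ := Choice.on group_mod.
HB.instance Definition _ := EqQuotient.on group_mod.

Definition to_group_mod (x : G) : group_mod := \pi_group_mod x.

Definition gmod_one : group_mod := to_group_mod 1.
Definition gmod_mul (x y : group_mod) : group_mod :=
  to_group_mod (repr x * repr y).
Definition gmod_inv (x : group_mod) : group_mod := to_group_mod (repr x)^-1.

Lemma to_group_modP x y :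
  to_group_mod x = to_group_mod y <-> normal_closure R (x^-1 * y).
Proof.
split; first by move/eqmodP => /asboolP.
by move=> xy; apply/eqmodP/asboolP.
Qed.

Lemma to_group_mod_repr (x : group_mod) : to_group_mod (repr x) = x.
Proof. exact: reprK. Qed.

Lemma gmod_mulE x y :
  gmod_mul (to_group_mod x) (to_group_mod y) = to_group_mod (x * y).
Proof.
have /to_group_modP xx := to_group_mod_repr (to_group_mod x).
have /to_group_modP yy := to_group_mod_repr (to_group_mod y).
apply/to_group_modP; rewrite invgM.
have := normal_closureM (normal_closureJ (repr (to_group_mod y)) xx) yy.
by rewrite /conjg !mulgA mulgK.
Qed.

Lemma gmod_invE x : gmod_inv (to_group_mod x) = to_group_mod x^-1.
Proof.
have /to_group_modP xx := to_group_mod_repr (to_group_mod x).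
apply/to_group_modP; have := normal_closureJ x^-1 (normal_closureV xx).
by rewrite /conjg invgM !invgK !mulgA mulgV mul1g.
Qed.

Lemma gmod_mulA : associative gmod_mul.
Proof.
move=> x y z.
rewrite -[x]to_group_mod_repr -[y]to_group_mod_repr -[z]to_group_mod_repr.
by rewrite !gmod_mulE mulgA.
Qed.

Lemma gmod_mul1 : left_id gmod_one gmod_mul.
Proof. by move=> x; rewrite -[x]to_group_mod_repr gmod_mulE mul1g. Qed.

Lemma gmod_mulr1 : right_id gmod_one gmod_mul.
Proof. by move=> x; rewrite -[x]to_group_mod_repr gmod_mulE mulg1. Qed.

Lemma gmod_mulV : left_inverse gmod_one gmod_inv gmod_mul.
Proof.
by move=> x; rewrite -[x]to_group_mod_repr gmod_invE gmod_mulE mulVg.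
Qed.

Lemma gmod_mulrV : right_inverse gmod_one gmod_inv gmod_mul.
Proof.
by move=> x; rewrite -[x]to_group_mod_repr gmod_invE gmod_mulE mulgV.
Qed.

HB.instance Definition _ := isGroup.Build group_mod
  gmod_mulA gmod_mul1 gmod_mulr1 gmod_mulV gmod_mulrV.

Lemma to_group_modM : {morph to_group_mod : x y / x * y}.
Proof. by move=> x y; rewrite -gmod_mulE. Qed.
HB.instance Definition _ :=
  isMultiplicative.Build G group_mod to_group_mod to_group_modM.

End GroupMod.

(* [word_group inv B] is the group of words over the alphabet L, under
   concatenation, modulo the congruence generated by B and by
   l (inv l) = (inv l) l = 1; [inv l] is the letter standing for l^-1.  Free
   groups and free products are the two instances used below. *)

Section WordGroup.
Variables (L : choiceType) (inv : L -> L) (B : seq L -> seq L -> Prop).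

Inductive word_cong : seq L -> seq L -> Prop :=
| word_cong_refl u : word_cong u u
| word_cong_sym u v : word_cong u v -> word_cong v u
| word_cong_trans v u w : word_cong u v -> word_cong v w -> word_cong u w
| word_cong_cat u u' v v' :
    word_cong u u' -> word_cong v v' -> word_cong (u ++ v) (u' ++ v')
| word_cong_mulV l : word_cong [:: l; inv l] [::]
| word_cong_Vmul l : word_cong [:: inv l; l] [::]
| word_cong_base u v : B u v -> word_cong u v.

Definition word_inv (u : seq L) : seq L := rev (map inv u).

Lemma word_mulV u : word_cong (u ++ word_inv u) [::].
Proof.
elim: u => [|l u IH]; first exact: word_cong_refl.
rewrite /word_inv /= rev_cons -cats1 catA -/(word_inv u) -cat1s.
apply: word_cong_trans (word_cong_mulV l).
rewrite -[[:: l; inv l]]/([:: l] ++ [:: inv l]).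
apply: word_cong_cat; first exact: word_cong_refl.
rewrite -[X in word_cong _ X]cat0s.
by apply: word_cong_cat; [exact: IH | exact: word_cong_refl].
Qed.

Lemma word_Vmul u : word_cong (word_inv u ++ u) [::].
Proof.
elim: u => [|l u IH]; first exact: word_cong_refl.
rewrite /word_inv /= rev_cons -cats1 -catA /=.
apply: word_cong_trans IH; apply: word_cong_cat; first exact: word_cong_refl.
rewrite -[_ :: _ :: _]/([:: inv l; l] ++ u) -[X in word_cong _ X]cat0s.
by apply: word_cong_cat; [exact: word_cong_Vmul | exact: word_cong_refl].
Qed.

Lemma word_cong_inv u v : word_cong u v -> word_cong (word_inv u) (word_inv v).
Proof.
move=> uv; apply: (@word_cong_trans (word_inv u ++ (v ++ word_inv v))).
  rewrite -[X in word_cong X]cats0; apply: word_cong_cat.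
    exact: word_cong_refl.
  exact/word_cong_sym/word_mulV.
rewrite catA -[X in word_cong _ X]cat0s; apply: word_cong_cat; last first.
  exact: word_cong_refl.
apply: word_cong_trans (word_Vmul u); apply: word_cong_cat.
  exact: word_cong_refl.
exact: word_cong_sym.
Qed.

Definition word_rel : rel (seq L) := fun u v => `[< word_cong u v >].

Lemma word_rel_refl : reflexive word_rel.
Proof. by move=> u; apply/asboolP; exact: word_cong_refl. Qed.

Lemma word_rel_sym : symmetric word_rel.
Proof. by move=> u v; apply/asboolP/asboolP; exact: word_cong_sym. Qed.

Lemma word_rel_trans : transitive word_rel.
Proof.
by move=> v u w /asboolP uv /asboolP vw; apply/asboolP; exact: word_cong_trans uv vw.
Qed.

Canonical word_equiv :=
  EquivRel word_rel word_rel_refl word_rel_sym word_rel_trans.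

Definition word_group : Type := {eq_quot word_rel}.
HB.instance Definition _ := Choice.on word_group.
HB.instance Definition _ := EqQuotient.on word_group.

Definition word_class (u : seq L) : word_group := \pi_word_group u.

Definition wg_one : word_group := word_class [::].
Definition wg_mul (x y : word_group) : word_group :=
  word_class (repr x ++ repr y).
Definition wg_inv (x : word_group) : word_group :=
  word_class (word_inv (repr x)).

Lemma word_classP u v : word_class u = word_class v <-> word_cong u v.
Proof.
split; first by move/eqmodP => /asboolP.
by move=> uv; apply/eqmodP/asboolP.
Qed.

Lemma word_class_repr (x : word_group) : word_class (repr x) = x.
Proof. exact: reprK. Qed.

Lemma wg_mulE u v : wg_mul (word_class u) (word_class v) = word_class (u ++ v).
Proof.
by apply/word_classP; apply: word_cong_cat; apply/word_classP;
  exact: word_class_repr.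
Qed.

Lemma wg_invE u : wg_inv (word_class u) = word_class (word_inv u).
Proof.
by apply/word_classP; apply: word_cong_inv; apply/word_classP;
  exact: word_class_repr.
Qed.

Lemma wg_mulA : associative wg_mul.
Proof.
move=> x y z.
rewrite -[x]word_class_repr -[y]word_class_repr -[z]word_class_repr.
by rewrite !wg_mulE catA.
Qed.

Lemma wg_mul1 : left_id wg_one wg_mul.
Proof. by move=> x; rewrite -[x]word_class_repr wg_mulE. Qed.

Lemma wg_mulr1 : right_id wg_one wg_mul.
Proof. by move=> x; rewrite -[x]word_class_repr wg_mulE cats0. Qed.

Lemma wg_mulV : left_inverse wg_one wg_inv wg_mul.
Proof.
move=> x; rewrite -[x]word_class_repr wg_invE wg_mulE.
exact/word_classP/word_Vmul.
Qed.

Lemma wg_mulrV : right_inverse wg_one wg_inv wg_mul.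
Proof.
move=> x; rewrite -[x]word_class_repr wg_invE wg_mulE.
exact/word_classP/word_mulV.
Qed.

HB.instance Definition _ := isGroup.Build word_group
  wg_mulA wg_mul1 wg_mulr1 wg_mulV wg_mulrV.

Lemma word_classM u v : word_class (u ++ v) = word_class u * word_class v.
Proof. by rewrite -wg_mulE. Qed.

End WordGroup.

(* The letter (i, true) is the generator i and (i, false) its inverse. *)
Definition free_group (I : choiceType) : groupType :=
  @word_group (I * bool)%type (fun l => (l.1, ~~ l.2)) (fun _ _ => False).

Definition free_gen (I : choiceType) (i : I) : free_group I :=
  word_class _ _ [:: (i, true)].

(* The letters of the free product are the pairs (i, x) with x in K i. *)
Section FreeProduct.
Variables (I : choiceType) (K : I -> groupType).

Definition letter_inv (l : {i : I & K i}) : {i : I & K i} :=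
  Tagged K (tagged l)^-1.

Inductive free_product_rel : seq {i : I & K i} -> seq {i : I & K i} -> Prop :=
| free_product_rel1 (i : I) : free_product_rel [:: Tagged K (1 : K i)] [::]
| free_product_relM (i : I) (x y : K i) :
    free_product_rel [:: Tagged K x; Tagged K y] [:: Tagged K (x * y)].

Definition free_product : groupType := word_group letter_inv free_product_rel.

Definition free_product_incl (i : I) (x : K i) : free_product :=
  word_class _ _ [:: Tagged K x].

End FreeProduct.

Definition presented_group (I : choiceType) (R : set (free_group I)) : groupType :=
  group_mod R.

Definition presented_gen (I : choiceType) (R : set (free_group I)) (i : I) :
  presented_group R := to_group_mod R (free_gen i).

(* G has the presentation <S | R>; the generators are the elements of the
   subset S of G, and the isomorphism is the one induced by the inclusion. *)
Definition has_presentation (G : groupType) (S : set G)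
    (R : set (free_group S)) : Prop :=
  exists f : {multiplicative presented_group R -> G},
    bijective f /\ forall s : S, f (presented_gen R s) = val s.

Definition RAAG_generating_set (G : groupType) (S : set G) : Prop :=
  exists R : set (free_group S),
    (forall r, R r -> exists s t : S, r = [~ free_gen s, free_gen t]) /\
    has_presentation R.

(* The edge e_i, i : 'I_m, runs from the centre to the i-th leaf, so alpha i
   maps its group to the central vertex group and omega i to the i-th external
   vertex group. *)
Record star_of_groups (m : nat) := StarOfGroups {
  central_group : groupType;
  external_group : 'I_m -> groupType;
  edge_group : 'I_m -> groupType;
  alpha : forall i, {multiplicative edge_group i -> central_group};
  omega : forall i, {multiplicative edge_group i -> external_group i};
  alpha_inj : forall i, injective (alpha i);
  omega_inj : forall i, injective (omega i)
}.

Section StarFundamentalGroup.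
Variables (m : nat) (GG : star_of_groups m).

(* [None] is the central vertex and [Some i] the i-th leaf. *)
Definition vertex_group (v : option 'I_m) : groupType :=
  if v is Some i then external_group GG i else central_group GG.

Definition vertex_product : groupType := free_product vertex_group.

Definition central_incl (x : central_group GG) : vertex_product :=
  @free_product_incl _ vertex_group None x.

Definition external_incl (i : 'I_m) (x : external_group GG i) : vertex_product :=
  @free_product_incl _ vertex_group (Some i) x.

Definition edge_relators : set vertex_product :=
  [set r | exists (i : 'I_m) (g : edge_group GG i),
     r = central_incl (alpha GG i g) / external_incl (omega GG i g)].

Definition fundamental_group : groupType := group_mod edge_relators.

End StarFundamentalGroup.

(* Main.v *)
Require Import Defs.
From HB Require Import structures.
From mathcomp Require Import all_boot all_order all_algebra.
From mathcomp Require Import mathcomp_extra boolp classical_sets cardinality.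
From mathcomp Require Import zify ring.

Set Implicit Arguments.
Unset Strict Implicit.
Unset Printing Implicit Defensive.

Import Order.TTheory GRing.Theory Num.Theory.

Local Open Scope classical_set_scope.
Local Open Scope group_scope.

(** Why the group is Z-linear.  Let A = Z^n be the central group, let
    a_i = alpha_i(k_i), and let T consist of the external generators other than
    the s_i = omega_i(k_i).  The fundamental group G is generated by A and T,
    subject to the relations of A, the commutations between generators of the
    same external group, and the commutations between a_i and the generators
    that commute with s_i.

    Embedding in a graph product.  When a_i is a proper power in A or when the
    lines spanned by the a_i are in special position, G need not be a
    right-angled Artin group, but it embeds in a graph product of cyclic groups
    Z and Z/N.  The vertices are T together with finitely many functionals lam_x
    on A with values in Z or Z/N; those vanishing on a_i separate the elements
    of A / <a_i> (separating_functionals, from the Smith normal form of a_i).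
    An element g of A goes to the product over x of the lam_x(g)-th powers of
    the vertex generators.  The functional vertices are joined to each other, and
    a generator t of the i-th external group that commutes with s_i is joined
    exactly to the functionals that do not vanish on a_i; any other t is joined
    to no functional.  Hence an element of A whose image commutes vertex by
    vertex with t already commutes with t in G, which is what makes the map
    injective.

    Linearity of the graph product.  Each vertex v owns a block of coordinates
    and acts on this block alone, by an affine map whose translation part is a
    multiple of the weight sigma_v, which is 1 plus the sum of the leading
    coordinates of the vertices not joined to v.  The region of v is the set of
    vectors whose leading v-coordinate exceeds sigma_v.  On the cone of vectors
    whose blocks are dominated by their leading coordinates, which contains the
    orbit of the base point (word_elt_orbit), the rules of ping-pong hold: a
    nontrivial power of v sends a vector outside the region of v into it
    (region_move), vertices joined to v preserve that region (region_move_adj),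
    and the regions of two vertices that are not joined are disjoint
    (region_disjoint).

    Ping-pong in G.  The normal form theorem for graph products is bypassed: by
    induction on the number of T-syllables, if g sends the base point into the
    region of t, then a power of t can be split off g on the left, inside G,
    leaving fewer syllables (region_syllable).  An element that acts trivially
    can therefore be shortened until it lies in A, where the functionals
    detect it (Phi_faithful). *)

(** * Groups of invertible integer matrices *)

Definition GLint (n : nat) : Type := {A : 'M[int]_n | A \in unitmx}.
HB.instance Definition _ n := Choice.on (GLint n).
HB.instance Definition _ n := SubChoice.on (GLint n).

Section GLint.
Variable n : nat.
Local Open Scope ring_scope.
Implicit Types A B : GLint n.

Lemma GLmul_unit A B : val A *m val B \in unitmx.
Proof. by rewrite unitmx_mul (valP A) (valP B). Qed.
Lemma GLinv_unit A : invmx (val A) \in unitmx.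
Proof. by rewrite unitmx_inv (valP A). Qed.

Definition GLmul A B : GLint n := Sub (val A *m val B) (GLmul_unit A B).
Definition GLone : GLint n := Sub 1%:M (unitmx1 _ _).
Definition GLinv A : GLint n := Sub (invmx (val A)) (GLinv_unit A).

Lemma GLmulA : associative GLmul.
Proof. by move=> A B C; apply: val_inj; rewrite /= mulmxA. Qed.
Lemma GLmul1 : left_id GLone GLmul.
Proof. by move=> A; apply: val_inj; rewrite /= mul1mx. Qed.
Lemma GLmulr1 : right_id GLone GLmul.
Proof. by move=> A; apply: val_inj; rewrite /= mulmx1. Qed.
Lemma GLmulV : left_inverse GLone GLinv GLmul.
Proof. by move=> A; apply: val_inj; rewrite /= mulVmx ?(valP A). Qed.
Lemma GLmulrV : right_inverse GLone GLinv GLmul.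
Proof. by move=> A; apply: val_inj; rewrite /= mulmxV ?(valP A). Qed.

HB.instance Definition _ := isGroup.Build (GLint n)
  GLmulA GLmul1 GLmulr1 GLmulV GLmulrV.

Lemma mulmx_eqP (B C : 'M[int]_n) :
  (forall x : 'cV_n, B *m x = C *m x) -> B = C.
Proof.
move=> BC; apply/matrixP=> i j.
by move/matrixP: (BC (delta_mx j 0)) => /(_ i 0); rewrite -!colE !mxE.
Qed.

Definition linear_mx (f : 'cV[int]_n -> 'cV[int]_n) : 'M[int]_n :=
  \matrix_(i, j) f (delta_mx j 0) i 0.

Lemma linear_mxE f :
  (forall a x y, f (a *: x + y) = a *: f x + f y) ->
  forall x, linear_mx f *m x = f x.
Proof.
move=> lin x.
have f0 : f 0 = 0 by have := lin (-1) 0 0; rewrite scaler0 addr0 scaleN1r addNr.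
have fS (I : Type) (r : seq I) (c : I -> int) (u : I -> 'cV_n) :
    f (\sum_(i <- r) c i *: u i) = \sum_(i <- r) c i *: f (u i).
  by elim: r => [|i r IH]; rewrite ?big_nil // !big_cons lin IH.
rewrite [x in RHS]matrix_sum_delta.
under [in RHS]eq_bigr do rewrite big_ord1.
rewrite fS; apply/matrixP=> i j; rewrite (ord1 j) !mxE summxE.
by apply: eq_bigr => k _; rewrite !mxE mulrC.
Qed.

End GLint.

(** * The block of one vertex *)

Section Syllable.
Variable N : nat.
Local Open Scope ring_scope.
Implicit Types (f : 'Z_N -> int) (tors : bool) (c s : int) (j : 'Z_N).

(** The exponents killed by a vertex group, which is 'Z_N at a torsion vertex
    and Z at a free one. *)
Definition trivial_exp tors c := if tors then c%:~R == 0 :> 'Z_N else c == 0.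

(** The action of the c-th power of a vertex generator on the block f of that
    vertex, when the weight of the vertex is s.  At a torsion vertex the block
    is the regular representation of Z/N, with origin moved to 4 s times the
    basis vector at 0.  At a free vertex only the entries 0 and 1 move: they are
    the value and half the slope of a parabola with second difference 8 s, so
    that entry 0 grows in both directions. *)
Definition syllable tors c f s j : int :=
  if tors then f (j - c%:~R) + 4 * s * ((j == 0)%:R - (j == c%:~R)%:R)
  else if j == 0 then f 0 + 2 * c * f 1 + 4 * c ^+ 2 * s
  else if j == 1 then f 1 + 4 * c * s else f j.

Lemma syllable0 tors c f s j : trivial_exp tors c -> syllable tors c f s j = f j.
Proof.
rewrite /trivial_exp /syllable; case: tors => /eqP ->.
  by rewrite subr0 subrr mulr0 addr0.
case: eqP => [->|_]; first by ring.
by case: eqP => [->|//]; ring.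
Qed.

(** Both factors use the same s because a vertex does not change its own
    weight. *)
Lemma syllableD tors c c' f s j :
  syllable tors (c + c') f s j =
  syllable tors c (syllable tors c' f s) s j.
Proof.
have Z10 : (1 == 0 :> 'Z_N) = false by [].
rewrite /syllable; case: tors; last first.
  rewrite eqxx Z10 eqxx; case: ifP => _; first by ring.
  by case: ifP => _; ring.
rewrite subr_eq0 [j - _ == _]subr_eq [c'%:~R + _]addrC -rmorphD /=.
rewrite -[j - c%:~R - _]addrA -opprD -rmorphD /=.
by rewrite -!addrA; congr (_ + _); ring.
Qed.

Lemma syllable_linear tors c a f g s s' j :
  syllable tors c (fun k => a * f k + g k) (a * s + s') j =
  a * syllable tors c f s j + syllable tors c g s' j.
Proof. by rewrite /syllable; do ![case: ifP => _]; ring. Qed.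

Lemma eq_syllable tors c f g s j :
  f =1 g -> syllable tors c f s j = syllable tors c g s j.
Proof. by move=> fg; rewrite /syllable !fg. Qed.

(** Ping-pong inside one block.  As all entries are at most s, the new leading
    entry is at least 4 s - s at a torsion vertex, and at least
    4 c^2 s - 2 |c| s at a free one; the factor 4 also makes it dominate the
    other new entries, which is what allows the step to be repeated later. *)
Lemma syllable_grow tors c f s :
    ~~ trivial_exp tors c -> 1 <= s -> (forall j, `|f j| <= f 0) -> f 0 <= s ->
  s < syllable tors c f s 0 /\
  forall j, `|syllable tors c f s j| <= syllable tors c f s 0.
Proof.
rewrite /trivial_exp /syllable; case: tors => c0 s1 fle f0s.
  rewrite eqxx [0 == _]eq_sym (negPf c0) /= subr0 mulr1.
  have [y yE] : exists y, y = f (0 - c%:~R) by eexists.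
  have := fle (0 - c%:~R); rewrite -yE => yle.
  split=> [|j]; first by lia.
  case: (eqVneq j 0) => [->|j0].
    by rewrite [0 == _]eq_sym (negPf c0) subr0 -yE; lia.
  case: (eqVneq j c%:~R) => [->|jc].
    rewrite subrr; move: (fle 0) yle f0s; move: (f 0) => h /=; rewrite sub0r mulrN1; lia.
  by rewrite subr0 mulr0 addr0; move: (fle (j - c%:~R)) => {}yle'; lia.
rewrite eqxx expr2; have cc : c <= -1 \/ 1 <= c by lia.
have h0 := fle 0; have lh := fle 1; move: h0 lh f0s fle; move: (f 0) (f 1) => h l h0 lh hs fle.
(* With h = f 0 and l = f 1, linear arithmetic only needs these comparisons
   between the monomials of degree two and three. *)
have cl : 0 <= c * l + c * c * h.
  rewrite -mulrA -mulrDr; case: cc => cc; last by apply: mulr_ge0; nia.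
  by rewrite -mulrNN; apply: mulr_ge0; nia.
have cs : s <= c * c * s by rewrite ler_peMl; nia.
have ch : c * c * h <= c * c * s by rewrite ler_wpM2l; nia.
have grow : s < h + 2 * c * l + 4 * (c * c) * s by nia.
split=> // j; case: ifP => _; first by lia.
case: ifP => _; last by have := fle j; lia.
have cs' : `|c * s| <= c * c * s by case: cc => cc; nia.
by nia.
Qed.

End Syllable.

(** * A ping-pong representation of graph products of cyclic groups *)

Section GraphProduct.
Variables (N : nat) (V : finType) (adj : rel V) (tors : pred V).
Hypotheses (adj_sym : symmetric adj) (adj_irr : irreflexive adj).
Local Open Scope ring_scope.

(** The coordinate None is fixed by every vertex and keeps all weights positive
    on the orbit of the base point.  All blocks share the index type 'Z_N, which
    has the two elements 0 and 1 used by the free vertices. *)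
Definition coords : Type := option (V * 'Z_N).
HB.instance Definition _ := Finite.on coords.
Let dim := #|{: coords}|.
Implicit Types (x y : 'cV[int]_dim) (u v : V) (c : int) (i : coords).

Definition coord x i : int := x (enum_rank i) 0.

Definition weight v x : int :=
  coord x None + \sum_(u | (u != v) && ~~ adj v u) coord x (Some (u, 0)).

Definition vmove v c x : 'cV[int]_dim :=
  \col_k match enum_val k with
  | Some (u, j) =>
      if u == v then
        syllable (tors v) c (fun j => coord x (Some (v, j))) (weight v x) j
      else coord x (Some (u, j))
  | None => coord x None
  end.

Lemma coord_inj x y : coord x =1 coord y -> x = y.
Proof.
move=> xy; apply/matrixP=> k l; rewrite (ord1 l) -(enum_valK k); exact: xy.
Qed.

Lemma coord_lin a x y i : coord (a *: x + y) i = a * coord x i + coord y i.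
Proof. by rewrite /coord !mxE. Qed.

Lemma weight_lin a v x y : weight v (a *: x + y) = a * weight v x + weight v y.
Proof.
rewrite /weight coord_lin; under eq_bigr do rewrite coord_lin.
by rewrite big_split /= -big_distrr /=; ring.
Qed.

Lemma coord_move_None v c x : coord (vmove v c x) None = coord x None.
Proof. by rewrite /coord mxE enum_rankK. Qed.

Lemma coord_move v c x j :
  coord (vmove v c x) (Some (v, j)) =
  syllable (tors v) c (fun j => coord x (Some (v, j))) (weight v x) j.
Proof. by rewrite /coord mxE enum_rankK eqxx. Qed.

Lemma coord_move_neq u v c x j : u != v ->
  coord (vmove v c x) (Some (u, j)) = coord x (Some (u, j)).
Proof. by move=> uv; rewrite /coord mxE enum_rankK (negPf uv). Qed.

(** The weight of u only involves blocks of vertices that are neither u nor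
    joined to u.  This is the reason why each vertex acts by a group action and
    why joined vertices commute. *)
Lemma weight_move u v c x : (u == v) || adj u v -> weight u (vmove v c x) = weight u x.
Proof.
move=> uv; rewrite /weight coord_move_None; congr (_ + _).
apply: eq_bigr => w /andP[wu nuw]; rewrite coord_move_neq //.
by apply/eqP => wv; move: uv wu nuw; rewrite wv => /orP[/eqP->|->]; rewrite ?eqxx.
Qed.

Lemma vmove_linear v c a x y : vmove v c (a *: x + y) = a *: vmove v c x + vmove v c y.
Proof.
apply: coord_inj => -[[u j]|]; rewrite coord_lin; last first.
  by rewrite !coord_move_None coord_lin.
have [->|uv] := eqVneq u v; last by rewrite !coord_move_neq // coord_lin.
rewrite !coord_move weight_lin -syllable_linear; apply: eq_syllable => k.
exact: coord_lin.
Qed.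

Lemma vmoveD v c c' x : vmove v (c + c') x = vmove v c (vmove v c' x).
Proof.
apply: coord_inj => -[[u j]|]; last by rewrite !coord_move_None.
have [->|uv] := eqVneq u v; last by rewrite !coord_move_neq.
rewrite !coord_move syllableD weight_move ?eqxx //; apply: eq_syllable => k.
by rewrite coord_move.
Qed.

Lemma vmove_trivial v c x : trivial_exp N (tors v) c -> vmove v c x = x.
Proof.
move=> c0; apply: coord_inj => -[[u j]|]; last by rewrite coord_move_None.
have [->|uv] := eqVneq u v; last by rewrite coord_move_neq.
by rewrite coord_move syllable0.
Qed.

Lemma vmove_comm u v c c' x :
  adj u v -> vmove u c (vmove v c' x) = vmove v c' (vmove u c x).
Proof.
move=> uv; have nuv : u != v by apply: contraTneq uv => ->; rewrite adj_irr.
apply: coord_inj => -[[w j]|]; last by rewrite !coord_move_None.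
have [->|wu] := eqVneq w u.
  rewrite coord_move [RHS]coord_move_neq // coord_move weight_move ?uv ?orbT //.
  by apply: eq_syllable => k; rewrite coord_move_neq.
have [->|wv] := eqVneq w v; last by rewrite !coord_move_neq.
rewrite coord_move_neq 1?eq_sym // !coord_move weight_move ?[adj v u]adj_sym ?uv ?orbT //.
by apply: eq_syllable => k; rewrite coord_move_neq // eq_sym.
Qed.

Lemma trivial_exp0 b : trivial_exp N b 0.
Proof. by case: b => /=. Qed.

Definition vmove_mx v c := linear_mx (vmove v c).

Lemma vmove_mxE v c x : vmove_mx v c *m x = vmove v c x.
Proof. exact/linear_mxE/vmove_linear. Qed.

Lemma vmove_mx_unit v c : vmove_mx v c \in unitmx.
Proof.
suff /mulmx1_unit[] : vmove_mx v c *m vmove_mx v (- c) = 1%:M by [].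
apply: mulmx_eqP => x; rewrite -mulmxA !vmove_mxE -vmoveD subrr mul1mx.
exact/vmove_trivial/trivial_exp0.
Qed.

Definition vertex_elt v c : GLint dim := Sub (vmove_mx v c) (vmove_mx_unit v c).

Definition acts (A : GLint dim) x := val A *m x.

Lemma actsM A B x : acts (A * B)%g x = acts A (acts B x).
Proof. by rewrite /acts mulmxA. Qed.

Lemma acts1 x : acts 1%g x = x. Proof. exact: mul1mx. Qed.

Lemma acts_vertex v c x : acts (vertex_elt v c) x = vmove v c x.
Proof. exact: vmove_mxE. Qed.

Lemma acts_inj (A B : GLint dim) : (forall x, acts A x = acts B x) -> A = B.
Proof. by move=> AB; apply/val_inj/mulmx_eqP. Qed.

Lemma vertex_eltD v c c' :
  vertex_elt v (c + c') = (vertex_elt v c * vertex_elt v c')%g.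
Proof. by apply: acts_inj => x; rewrite actsM !acts_vertex vmoveD. Qed.

Lemma vertex_elt_trivial v c : trivial_exp N (tors v) c -> vertex_elt v c = 1%g.
Proof. by move=> c0; apply: acts_inj => x; rewrite acts_vertex vmove_trivial ?acts1. Qed.

Lemma vertex_elt_comm u v c c' :
  adj u v -> commute (vertex_elt u c) (vertex_elt v c').
Proof.
by move=> uv; apply: acts_inj => x; rewrite !actsM !acts_vertex vmove_comm.
Qed.

Definition region v x := weight v x < coord x (Some (v, 0)).

(** Domination by the leading entry makes all leading entries nonnegative, so
    that no cancellation occurs in a weight.  The cone itself is not invariant;
    only the orbit of the base point stays in it, by word_elt_orbit. *)
Definition cone x :=
  coord x None = 1 /\ forall v j, `|coord x (Some (v, j))| <= coord x (Some (v, 0)).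

Definition basepoint : 'cV[int]_dim := delta_mx (enum_rank None) 0.

Lemma coord_basepoint i : coord basepoint i = (i == None)%:R.
Proof. by rewrite /coord mxE eqxx andbT (inj_eq enum_rank_inj). Qed.

Lemma weight_ge1 v x : cone x -> 1 <= weight v x.
Proof.
case=> x1 xle; rewrite /weight x1 lerDl sumr_ge0 // => u _.
exact: le_trans (xle u 0).
Qed.

Lemma cone_basepoint : cone basepoint.
Proof. by split=> [|v j]; rewrite !coord_basepoint. Qed.

Lemma basepoint_region v : ~~ region v basepoint.
Proof.
rewrite /region -leNgt coord_basepoint /=.
exact: le_trans (weight_ge1 v cone_basepoint).
Qed.

Lemma coord_lt_weight u v x :
  cone x -> u != v -> ~~ adj u v -> coord x (Some (v, 0)) < weight u x.
Proof.
case=> x1 xle uv nuv; rewrite /weight (bigD1 v) ?[v == u]eq_sym ?uv //= x1.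
rewrite addrCA ltrDl ltr_wpDr ?ltr01 // sumr_ge0 // => w _.
exact: le_trans (xle w 0).
Qed.

(** When u and v are not joined, the leading entry of each is a summand of the
    weight of the other, so both cannot exceed their weights. *)
Lemma region_disjoint u v x :
  cone x -> u != v -> ~~ adj u v -> region u x -> ~~ region v x.
Proof.
move=> xC uv nuv ux; rewrite /region -leNgt; apply: ltW.
apply: lt_trans (coord_lt_weight xC uv nuv) _; apply: lt_trans ux _.
by apply: coord_lt_weight; rewrite // 1?eq_sym // adj_sym.
Qed.

(** The region of u is defined without the block of v. *)
Lemma region_move_adj u v c x : adj u v -> region u (vmove v c x) = region u x.
Proof.
move=> uv; rewrite /region weight_move ?uv ?orbT // coord_move_neq //.
by apply: contraTneq uv => ->; rewrite adj_irr.
Qed.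

Lemma region_move v c x : cone x -> ~~ region v x -> ~~ trivial_exp N (tors v) c ->
  cone (vmove v c x) /\ region v (vmove v c x).
Proof.
move=> xC; rewrite /region -leNgt => xv c0; have [x1 xle] := xC.
have [lt_w le_w] := syllable_grow c0 (weight_ge1 v xC) (xle v) xv.
split; last by rewrite weight_move ?eqxx // coord_move.
split=> [|u j]; first by rewrite coord_move_None.
have [->|uv] := eqVneq u v; first by rewrite !coord_move.
by rewrite !coord_move_neq.
Qed.

Definition word_elt (w : seq (V * int)) : GLint dim :=
  foldr (fun l A => (vertex_elt l.1 l.2 * A)%g) 1%g w.

Lemma word_elt_cat w w' : word_elt (w ++ w') = (word_elt w * word_elt w')%g.
Proof. by elim: w => [|l w IH]; rewrite /= ?mul1g // IH mulgA. Qed.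

(** The two claims need each other.  A letter preserves the cone only if it is
    applied outside its own region; inside the region, the second claim moves an
    earlier power of the same vertex to the front of the remaining word, where
    the letter absorbs it and the word gets shorter. *)
Lemma word_elt_orbit w :
  cone (acts (word_elt w) basepoint) /\
  forall v, region v (acts (word_elt w) basepoint) ->
    exists c w', (size w' < size w)%N /\ word_elt w = (vertex_elt v c * word_elt w')%g.
Proof.
have [n] := ubnP (size w); elim: n w => // n IH [|[u c] w] /= szw.
  rewrite acts1; split=> [|v]; first exact: cone_basepoint.
  by rewrite (negPf (basepoint_region v)).
have [wC wD] := IH w szw.
(* The letter (u, c) meets a power of u already present: merge the two. *)
have [/wD[c' [w2 [sz2 w2E]]]|w_u] := boolP (region u (acts (word_elt w) basepoint)).
  have [|C2 D2] := IH ((u, c + c') :: w2); first exact: leq_ltn_trans sz2 szw.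
  move: C2 D2; rewrite /= vertex_eltD -mulgA -w2E => C2 D2.
  split=> // v /D2[d [w3 [sz3 w3E]]].
  by exists d, w3; split=> //; exact: leq_trans sz3 (leqW sz2).
have [c0|c0] := boolP (trivial_exp N (tors u) c).
  rewrite vertex_elt_trivial // mul1g; split=> // v /wD[c' [w2 [sz2 w2E]]].
  by exists c', w2; split=> //; exact: ltnW.
have [stepC stepD] := region_move wC w_u c0.
rewrite actsM acts_vertex; split=> // v.
have [->|vu] := eqVneq v u; first by exists c, w.
(* The first letter is now u.  A region containing the image is that of u, or
   of a vertex joined to u, and then its power jumps over the letter u. *)
have [vu_adj|nadj] := boolP (adj v u); last first.
  move=> /(region_disjoint stepC vu nadj); by rewrite stepD.
rewrite region_move_adj // => /wD[c' [w2 [sz2 w2E]]].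
exists c', ((u, c) :: w2); split=> //=.
by rewrite w2E !mulgA vertex_elt_comm // adj_sym.
Qed.

End GraphProduct.

(** * Splitting off syllables by ping-pong *)

Section Faithfulness.
Variables (G : groupType) (A : zmodType) (X T : finType) (N : nat).
Variables (iota : A -> G) (syl : T -> int -> G).
Variables (lam : X -> A -> int) (tors : pred X).
Variables (J : T -> pred X) (E : rel T).
Hypotheses (iotaD : forall a b, iota (a + b)%R = iota a * iota b).
Hypotheses (sylD : forall t c c', syl t (c + c')%R = syl t c * syl t c').
Hypotheses (E_sym : symmetric E) (E_irr : irreflexive E).

(** The graph on functionals X and external generators T: the functionals form
    a clique, since they carry the abelian group A. *)
Definition adjacent (u v : X + T) : bool :=
  match u, v with
  | inl x, inl y => x != y
  | inl x, inr t | inr t, inl x => J t x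
  | inr t, inr t' => E t t'
  end.

Definition torsion (u : X + T) : bool := if u is inl x then tors x else false.

Lemma adjacent_sym : symmetric adjacent.
Proof. by case=> [x|t] [y|t'] //=; rewrite 1?eq_sym 1?E_sym. Qed.

Lemma adjacent_irr : irreflexive adjacent.
Proof. by case=> [x|t] /=; rewrite ?eqxx ?E_irr. Qed.

Local Notation elt := (vertex_elt N adjacent torsion).
Local Notation welt := (word_elt N adjacent torsion).
Local Notation reg := (region adjacent).
Local Notation triv x a := (trivial_exp N (tors x) (lam x a)).
Local Notation base := (basepoint N (X + T)%type).

(** The image of a in the graph product, restricted to the functionals in r. *)
Definition central_on (r : seq X) (a : A) := welt [seq (inl x, lam x a) | x <- r].
Definition central_elt := central_on (enum X).

Lemma central_on_cat r r' a : central_on (r ++ r') a = central_on r a * central_on r' a.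
Proof. by rewrite /central_on map_cat word_elt_cat. Qed.

Lemma central_on_cons x r a :
  central_on (x :: r) a = elt (inl x) (lam x a) * central_on r a.
Proof. by []. Qed.

Lemma elt_commute_inl x y c c' : commute (elt (inl x) c) (elt (inl y) c').
Proof.
have [->|xy] := eqVneq x y; first by rewrite /commute -!vertex_eltD addrC.
by apply: vertex_elt_comm xy; [exact: adjacent_sym | exact: adjacent_irr].
Qed.

Lemma central_on_commute (B : GLint _) r a :
  (forall x, x \in r -> commute B (elt (inl x) (lam x a))) -> commute B (central_on r a).
Proof.
elim: r => [|x r IH] Br; first exact: commute1.
apply: commuteM; first by apply: Br; rewrite mem_head.
by apply: IH => y yr; apply: Br; rewrite in_cons yr orbT.
Qed.

Lemma central_on_commute2 r r' a a' : commute (central_on r a) (central_on r' a').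
Proof.
apply: central_on_commute => x _; apply/commute_sym/central_on_commute => y _.
exact: elt_commute_inl.
Qed.

Lemma central_on_perm r r' a : perm_eq r r' -> central_on r a = central_on r' a.
Proof.
move/(catCA_perm_subst (F := central_on ^~ a)); apply=> r1 r2 r3.
by rewrite !central_on_cat !mulgA (central_on_commute2 r1 r2).
Qed.

Lemma central_eltD (lamD : forall x a b, lam x (a + b)%R = (lam x a + lam x b)%R) a b :
  central_elt (a + b)%R = central_elt a * central_elt b.
Proof.
rewrite /central_elt; elim: (enum X) => [|x r IH]; first by rewrite /central_on mulg1.
rewrite !central_on_cons lamD vertex_eltD IH -!mulgA; congr (_ * _).
rewrite !mulgA; congr (_ * _); apply: central_on_commute => y _.
exact: elt_commute_inl.
Qed.

(** Only the functionals that are nontrivial on a contribute a letter. *)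
Lemma central_on_region r a u x :
  (forall v, v \in r -> ~~ triv v a -> adjacent u (inl v)) ->
  reg u (acts (central_on r a) x) = reg u x.
Proof.
elim: r => [|v r IH] adj_r; first by rewrite acts1.
rewrite central_on_cons actsM.
have [v0|v0] := boolP (triv v a).
  rewrite vertex_elt_trivial // acts1 IH // => w wr.
  by apply: adj_r; rewrite in_cons wr orbT.
rewrite acts_vertex region_move_adj; first last.
- by apply: adj_r => //; rewrite mem_head.
- exact: adjacent_irr.
by apply: IH => w wr; apply: adj_r; rewrite in_cons wr orbT.
Qed.

Definition orbit x := exists w, x = acts (welt w) base.

Lemma orbit_cone x : orbit x -> cone x.
Proof.
by case=> w ->; case: (word_elt_orbit N torsion adjacent_sym adjacent_irr w).
Qed.

Lemma orbit_welt w x : orbit x -> orbit (acts (welt w) x).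
Proof. by case=> w' ->; exists (w ++ w'); rewrite word_elt_cat actsM. Qed.

Lemma orbit_elt v c x : orbit x -> orbit (acts (elt v c) x).
Proof. by move/(orbit_welt [:: (v, c)]); rewrite /= mulg1. Qed.

Lemma orbit_disjoint u v x :
  orbit x -> u != v -> ~~ adjacent u v -> reg u x -> reg v x -> False.
Proof.
move=> /orbit_cone xC uv nuv ux.
by apply/negP/(region_disjoint adjacent_sym xC uv nuv ux).
Qed.

(** The letter of v can be applied last, because the functionals form a clique
    and therefore preserve both the region of v and its complement. *)
Lemma central_elt_region v a x : orbit x -> ~~ reg (inl v) x -> ~~ triv v a ->
  reg (inl v) (acts (central_elt a) x).
Proof.
move=> xO nx va; have v_enum : v \in enum X by rewrite mem_enum.
rewrite /central_elt (central_on_perm _ (perm_to_rem v_enum)).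
rewrite central_on_cons actsM acts_vertex.
apply: (region_move _ _ va).2; first exact/orbit_cone/orbit_welt.
rewrite central_on_region // => w /=.
by rewrite (rem_filter _ (enum_uniq _)) mem_filter eq_sym => /andP[].
Qed.

Lemma elt_region t c x : orbit x -> ~~ reg (inr t) x -> c != 0%R ->
  reg (inr t) (acts (elt (inr t) c) x).
Proof.
move=> /orbit_cone xC nx c0; rewrite acts_vertex.
exact: (region_move (tors := torsion) (v := inr t) xC nx c0).2.
Qed.

Lemma elt_region_adj u v c x :
  adjacent u v -> reg u (acts (elt v c) x) = reg u x.
Proof. by move=> uv; rewrite acts_vertex region_move_adj //; exact: adjacent_irr. Qed.

(** Products with r syllables from T, separated by arbitrary elements of A; this
    length measures progress in the ping-pong below. *)
Inductive syllables : nat -> G -> Prop :=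
| syllables0 a : syllables 0 (iota a)
| syllablesS r a t c g : syllables r g -> syllables r.+1 (iota a * syl t c * g).

Lemma syllables_iota r a g : syllables r g -> syllables r (iota a * g).
Proof.
case=> [b|{}r b t c h hr]; first by rewrite -iotaD; exact: syllables0.
by rewrite !mulgA -iotaD; exact: syllablesS.
Qed.

Lemma iota0 : iota 0%R = 1.
Proof. by apply: (mulgI (iota 0%R)); rewrite -iotaD addr0 mulg1. Qed.

Lemma syl0 t : syl t 0%R = 1.
Proof. by apply: (mulgI (syl t 0%R)); rewrite -sylD addr0 mulg1. Qed.

Lemma syllables_syl r t c g : syllables r g -> syllables r.+1 (syl t c * g).
Proof. by rewrite -[syl t c]mul1g -iota0; exact: syllablesS. Qed.

Variable Phi : G -> GLint #|{: coords N (X + T)%type}|.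
Hypothesis PhiM : {morph Phi : g h / g * h}.
Hypothesis Phi_iota : forall a, Phi (iota a) = central_elt a.
Hypothesis Phi_syl : forall t c, Phi (syl t c) = elt (inr t) c.
Hypothesis syl_commute : forall t t' c c', E t t' -> commute (syl t c) (syl t' c').
(* In a star of groups, J t is either empty or determined by the leaf of t. *)
Hypothesis J_nested : forall t t', E t t' ->
  {subset J t <= J t'} \/ {subset J t' <= J t}.
(* This is the source of injectivity: if every letter of the image of a commutes
   with t in the graph product, then a commutes with t already in G. *)
Hypothesis iota_syl_commute : forall a t c,
  (forall x, ~~ triv x a -> J t x) -> commute (iota a) (syl t c).

Let pt g := acts (Phi g) base.

Let ptM g h : pt (g * h) = acts (Phi g) (pt h).
Proof. by rewrite /pt PhiM actsM. Qed.

Let orbit_pt r g : syllables r g -> orbit (pt g).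
Proof.
have orb0 : orbit base by exists [::]; rewrite acts1.
elim=> {r g} [a|r a t c g _ IH].
  by rewrite /pt Phi_iota; exact: orbit_welt.
by rewrite -mulgA !ptM Phi_iota Phi_syl; apply/orbit_welt/orbit_elt.
Qed.

Let outside a t : (forall x, ~~ triv x a -> J t x) \/ exists2 x, ~~ triv x a & ~~ J t x.
Proof.
have [/existsP[x /andP[]]|] := boolP [exists x, ~~ triv x a && ~~ J t x].
  by right; exists x.
rewrite negb_exists => /forallP out; left=> x xa.
by have := out x; rewrite xa negbK.
Qed.

(** If a involves a functional x not joined to t, the image lies in the region of
    x, which is disjoint from that of t; otherwise the region of t is preserved,
    and it does not contain the base point. *)
Lemma iota_not_in_region a t : ~~ reg (inr t) (pt (iota a)).
Proof.
have orb0 : orbit base by exists [::]; rewrite acts1.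
rewrite /pt Phi_iota; have [Ja|[x xa nJ]] := outside a t.
  by rewrite central_on_region ?basepoint_region // => v _; exact: Ja.
apply/negP => Dt; apply: (orbit_disjoint (orbit_welt _ orb0) _ _ Dt (v := inl x)) => //.
exact: central_elt_region (basepoint_region _ _ _) xa.
Qed.

(** A power of t can be split off g in G as soon as g moves the base point into
    the region of t.  Write g = a t1^c g1.  If the image of g1 is outside the
    region of t1, the image q of t1^c g1 is inside it, and a functional that is
    nontrivial on a but not joined to t1 would put the image of g in its own
    region, so it must be joined to t.  The nestedness of the neighbourhoods of
    commuting generators then decides whether a commutes with t1 or with t. *)
Lemma region_syllable r g t : syllables r g -> reg (inr t) (pt g) ->
  exists c r' h, [/\ (r' < r)%N, syllables r' h & g = syl t c * h].
Proof.
have [n] := ubnP r; elim: n => // n IH in r g t *; rewrite ltnS => rn gr.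
case: gr rn => {r g} [a|r a t1 c g gr] rn.
  by move=> D; have := iota_not_in_region a t; rewrite D.
have [c0|c0] := eqVneq c 0%R.
  have gE : iota a * syl t1 c * g = iota a * g by rewrite c0 syl0 mulg1.
  rewrite gE => /(IH _ _ _ rn (syllables_iota a gr))[d [r' [h [r'r hr' ->]]]].
  by exists d, r', h; split=> //; exact: ltnW.
(* A power of t1 begins g: it merges with the syllable of t1. *)
have [Dt1|nDt1] := boolP (reg (inr t1) (pt g)).
  have [d [r' [h [r'r hr' gE]]]] := IH _ _ _ rn gr Dt1.
  have gE' : iota a * syl t1 c * g = iota a * syl t1 (c + d)%R * h.
    by rewrite gE sylD !mulgA.
  rewrite gE' => /(IH _ _ _ (leq_ltn_trans r'r rn) (syllablesS a t1 _ hr')).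
  move=> [d' [r2 [h2 [r2r hr2 ->]]]]; exists d', r2, h2; split=> //.
  exact: leq_trans r2r (leqW r'r).
set q := pt (syl t1 c * g); have qO : orbit q := orbit_pt (syllables_syl t1 c gr).
have Dq : reg (inr t1) q.
  by rewrite /q ptM Phi_syl; apply: elt_region nDt1 c0; exact: orbit_pt gr.
have ptE : pt (iota a * syl t1 c * g) = acts (central_elt a) q.
  by rewrite -mulgA ptM Phi_iota.
rewrite ptE => D.
have out x : ~~ triv x a -> ~~ J t1 x -> J t x.
  move=> xa nJ1; have nDx : ~~ reg (inl x) q.
    by apply/negP; exact: orbit_disjoint qO _ _ Dq.
  have := central_elt_region qO nDx xa; apply: contraTT => nJ.
  by apply/negP; exact: orbit_disjoint (orbit_welt _ qO) _ _ D.
have [tt1|tt1] := eqVneq t t1.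
  have comm : commute (iota a) (syl t1 c).
    apply: iota_syl_commute => x xa; rewrite -[J t1 x]negbK; apply/negP => nJ.
    by have := out x xa nJ; rewrite tt1 (negPf nJ).
  exists c, r, (iota a * g); split=> //; first exact: syllables_iota.
  by rewrite tt1 mulgA comm.
(* If t and t1 are not joined, split the letters of a into those joined to t,
   which preserve the region of t, and the others, all joined to t1 by out, which
   preserve the region of t1; this puts one vector in two disjoint regions. *)
have [Ett1|nE] := boolP (E t t1); last first.
  pose r1 := filter (J t) (enum X); pose r2 := filter (predC (J t)) (enum X).
  have aE : central_elt a = central_on r1 a * central_on r2 a.
    by rewrite -central_on_cat; apply: central_on_perm; rewrite perm_sym perm_filterC.
  move: D; rewrite aE actsM central_on_region => [|x]; last first.
    by rewrite mem_filter => /andP[].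
  move=> D; exfalso; apply: (orbit_disjoint (orbit_welt _ qO) _ _ D (v := inr t1)) => //.
  rewrite central_on_region // => x; rewrite mem_filter => /andP[/= nJ _] xa.
  by apply: contraNT nJ; exact: out.
(* Here a commutes with t1, and the induction hypothesis applies to a g. *)
have [Jsub|Jsub] := J_nested Ett1.
  have comm : commute (iota a) (syl t1 c).
    apply: iota_syl_commute => x xa; have [//|nJ] := boolP (J t1 x).
    by rewrite -(negPf nJ); exact: (Jsub x (out x xa nJ)).
  have gE : iota a * syl t1 c * g = syl t1 c * (iota a * g) by rewrite comm mulgA.
  have : reg (inr t) (pt (iota a * g)).
    by move: D; rewrite -ptE gE ptM Phi_syl elt_region_adj.
  move=> /(IH _ _ _ rn (syllables_iota a gr))[d [r' [h [r'r hr' hE]]]].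
  exists d, r'.+1, (syl t1 c * h); split=> //; first exact: syllables_syl.
  by rewrite gE hE !mulgA (syl_commute d c Ett1).
(* Here a commutes with t, and the induction hypothesis applies to g. *)
have Jt x : ~~ triv x a -> J t x.
  by move=> xa; have [xJ|] := boolP (J t1 x); [exact: (Jsub x xJ) | exact: out].
have : reg (inr t) (pt g).
  move: D; rewrite central_on_region => [|x _]; last exact: Jt.
  by rewrite /q ptM Phi_syl elt_region_adj.
move=> /(IH _ _ _ rn gr)[d [r' [h [r'r hr' hE]]]].
exists d, r'.+1, (iota a * syl t1 c * h); split=> //; first exact: syllablesS.
rewrite hE !mulgA; congr (_ * h).
by rewrite -[LHS]mulgA -(syl_commute d c Ett1) mulgA (iota_syl_commute d Jt).
Qed.

Hypothesis lam_separates : forall a, (forall x, triv x a) -> a = 0%R.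
Hypothesis generation : forall P : G -> Prop, P 1 ->
  (forall a g, P g -> P (iota a * g)) -> (forall t c g, P g -> P (syl t c * g)) ->
  forall g, P g.

Lemma exists_syllables g : exists r, syllables r g.
Proof.
elim/generation: g => [|a g [r gr]|t c g [r gr]].
- by exists 0; rewrite -iota0; exact: syllables0.
- by exists r; exact: syllables_iota.
- by exists r.+1; exact: syllables_syl.
Qed.

(** A product a t^c g with trivial image either can be shortened, or sends the
    base point, through t^c g, to a vector of the region of t that is also the
    image of -a, which iota_not_in_region excludes.  Without syllables, the
    functionals detect a. *)
Lemma Phi_faithful g : Phi g = 1 -> g = 1.
Proof.
have orb0 : orbit base by exists [::]; rewrite acts1.
have [r] := exists_syllables g; have [n] := ubnP r.
elim: n => // n IH in r g *; rewrite ltnS => rn gr.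
case: gr rn => {r g} [a|r a t c g gr] rn Phi1.
  rewrite (lam_separates (a := a)) ?iota0 // => x; apply/negPn/negP => xa.
  have := central_elt_region orb0 (basepoint_region _ _ _) xa.
  by rewrite -Phi_iota Phi1 acts1 (negPf (basepoint_region _ _ _)).
have [c0|c0] := eqVneq c 0%R.
  move: Phi1; rewrite c0 syl0 mulg1 => Phi1.
  exact: IH rn (syllables_iota a gr) Phi1.
have [/(region_syllable gr)[d [r' [h [r'r hr' gE]]]]|nD] := boolP (reg (inr t) (pt g)).
  have gE' : iota a * syl t c * g = iota a * syl t (c + d)%R * h.
    by rewrite gE sylD !mulgA.
  move: Phi1; rewrite gE'; apply: IH (syllablesS a t _ hr').
  exact: leq_ltn_trans r'r rn.
have: reg (inr t) (pt (syl t c * g)).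
  by rewrite ptM Phi_syl; apply: elt_region nD c0; exact: orbit_pt gr.
have -> : pt (syl t c * g) = pt (iota (- a)%R).
  rewrite -[syl t c * g]mul1g -iota0 -(addNr a) iotaD -!mulgA mulgA -mulgA ptM.
  by rewrite mulgA /pt Phi1 acts1.
by move=> D; have := iota_not_in_region (- a)%R t; rewrite D.
Qed.

End Faithfulness.

(** * Universal properties *)

Section Morphisms.
Variables (G H : groupType) (f : G -> H).
Hypothesis fM : {morph f : x y / x * y}.

Lemma morph_1 : f 1 = 1.
Proof. by apply: (mulgI (f 1)); rewrite -fM !mulg1. Qed.

Lemma morph_V x : f x^-1 = (f x)^-1.
Proof. by apply: (mulgI (f x)); rewrite -fM !mulgV morph_1. Qed.

Lemma morph_R x y : f [~ x, y] = [~ f x, f y].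
Proof. by rewrite /commg /conjg !fM !morph_V. Qed.

Lemma group_mod_morph (R : set G) : (forall r, R r -> f r = 1) ->
  exists F : group_mod R -> H,
    {morph F : x y / x * y} /\ forall x, F (to_group_mod R x) = f x.
Proof.
move=> fR; have ker x : normal_closure R x -> f x = 1.
  move=> /(_ [set y | f y = 1]); apply; split=> //; split=> [|y z /=]; last first.
    by rewrite /conjg !fM => ->; rewrite mul1g -fM mulVg morph_1.
  split=> [|y z]; rewrite !inE /=; first exact: morph_1.
  by move=> fy fz; rewrite fM morph_V fy fz mulgV.
have FE x : f (repr (to_group_mod R x)) = f x.
  have /to_group_modP/ker := to_group_mod_repr (to_group_mod R x).
  by rewrite fM morph_V => /mulg1_eq; rewrite invgK.
exists (fun x => f (repr x)); split=> // x y.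
by rewrite -[x in LHS]to_group_mod_repr -[y in LHS]to_group_mod_repr -to_group_modM FE fM.
Qed.

End Morphisms.

Lemma Z_linear_GLint (G : groupType) n (F : G -> GLint n) :
  {morph F : x y / x * y} -> (forall x, F x = 1 -> x = 1) -> Z_linear G.
Proof.
move=> FM Finj; exists n, (fun x => val (F x)); split=> [x|x y|x y /val_inj Fxy].
- exact: valP.
- by rewrite FM.
- by apply: (mulIg y^-1); rewrite mulgV; apply: Finj; rewrite FM morph_V // Fxy mulgV.
Qed.

Section WordMorphism.
Variables (L : choiceType) (inv : L -> L) (B : seq L -> seq L -> Prop).
Variables (H : groupType) (f : L -> H).
Hypothesis f_inv : forall l, f (inv l) = (f l)^-1.

Definition word_value (u : seq L) : H := foldr (fun l h => f l * h) 1 u.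
Hypothesis f_base : forall u v, B u v -> word_value u = word_value v.

Lemma word_value_cat u v : word_value (u ++ v) = word_value u * word_value v.
Proof. by elim: u => [|l u IH]; rewrite /= ?mul1g // IH mulgA. Qed.

Lemma word_value_cong u v : word_cong inv B u v -> word_value u = word_value v.
Proof.
elim=> {u v} //=.
- by move=> u v w _ -> _ ->.
- by move=> u u' v v' _ uE _ vE; rewrite !word_value_cat uE vE.
- by move=> l; rewrite f_inv mulg1 mulgV.
- by move=> l; rewrite f_inv mulg1 mulVg.
Qed.

Lemma word_group_morph : exists F : word_group inv B -> H,
  {morph F : x y / x * y} /\ forall l, F (word_class inv B [:: l]) = f l.
Proof.
have FE u : word_value (repr (word_class inv B u)) = word_value u.
  exact/word_value_cong/word_classP/word_class_repr.
exists (fun x => word_value (repr x)); split=> [x y|l]; last by rewrite FE /= mulg1.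
rewrite -[x in LHS]word_class_repr -[y in LHS]word_class_repr -word_classM FE.
exact: word_value_cat.
Qed.

Lemma word_group_ind (P : word_group inv B -> Prop) : P 1 ->
  (forall l x, P x -> P (word_class inv B [:: l] * x)) -> forall x, P x.
Proof.
move=> P1 PM x; rewrite -[x]word_class_repr; elim: (repr x) => [//|l u IH].
by rewrite -cat1s word_classM; exact: PM.
Qed.

End WordMorphism.

Lemma free_group_morph (I : choiceType) (H : groupType) (f : I -> H) :
  exists F : free_group I -> H,
    {morph F : x y / x * y} /\ forall i, F (free_gen i) = f i.
Proof.
pose g (l : I * bool) := if l.2 then f l.1 else (f l.1)^-1.
have [|//|F [FM FE]] := @word_group_morph (I * bool)%type
  (fun l => (l.1, ~~ l.2)) (fun _ _ => False) H g.
  by case=> i [] /=; rewrite /g ?invgK.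
by exists F; split=> // i; rewrite FE.
Qed.

Lemma free_group_ind (I : choiceType) (P : free_group I -> Prop) : P 1 ->
  (forall i x, P x -> P (free_gen i * x)) ->
  (forall i x, P x -> P ((free_gen i)^-1 * x)) -> forall x, P x.
Proof.
move=> P1 Pg PV; apply: word_group_ind => // -[i []] x Px; first exact: Pg.
suff -> : word_class (fun l : I * bool => (l.1, ~~ l.2)) (fun _ _ => False)
  [:: (i, false)] = (free_gen i)^-1 :> free_group I by exact: PV.
exact/esym/wg_invE.
Qed.

Lemma free_product_morph (I : choiceType) (K : I -> groupType) (H : groupType)
    (f : forall i, K i -> H) : (forall i, {morph f i : x y / x * y}) ->
  exists F : free_product K -> H, {morph F : x y / x * y} /\
    forall i (x : K i), F (free_product_incl x) = f i x.
Proof.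
move=> fM; have [||F [FM FE]] := @word_group_morph _ (@letter_inv _ K)
  (@free_product_rel _ K) H (fun l => f (tag l) (tagged l)).
- by case=> i x /=; exact: morph_V.
- move=> u v [i|i x y] /=; first by rewrite mulg1 (morph_1 (fM i)).
  by rewrite !mulg1 fM.
by exists F; split=> // i x; rewrite FE.
Qed.

Lemma free_product_inclM (I : choiceType) (K : I -> groupType) i :
  {morph @free_product_incl I K i : x y / x * y}.
Proof.
move=> x y; rewrite /free_product_incl -word_classM; apply/word_classP.
exact/word_cong_sym/word_cong_base/free_product_relM.
Qed.

Lemma free_product_ind (I : choiceType) (K : I -> groupType)
    (P : free_product K -> Prop) : P 1 ->
  (forall i (x : K i) y, P y -> P (free_product_incl x * y)) -> forall y, P y.
Proof. by move=> P1 PM; apply: word_group_ind => // -[i x] y; exact: PM. Qed.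

Section RAAG.
Variables (G : groupType) (S : set G).
Hypothesis RAAG : RAAG_generating_set S.

(** Since every relator is a commutator of two generators, the universal property
    can be stated without mentioning the relators: they only say that certain
    generators commute in G. *)
Lemma RAAG_morph (H : groupType) (f : S -> H) :
  (forall s t : S, commute (val s) (val t) -> commute (f s) (f t)) ->
  exists F : G -> H, {morph F : x y / x * y} /\ forall s : S, F (val s) = f s.
Proof.
case: RAAG => R [Rcomm [phi [[psi phiK psiK] phi_gen]]] fcomm.
have [F [FM FE]] := free_group_morph f.
have [|F' [F'M F'E]] := group_mod_morph FM (R := R).
  move=> r Rr; have [s [t rE]] := Rcomm r Rr; rewrite rE (morph_R FM) !FE.
  apply/eqP/commgP; apply: fcomm.
  rewrite -!phi_gen; apply: (gmulf_commute phi); apply/commgP/eqP.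
  have : to_group_mod R [~ free_gen s, free_gen t] = to_group_mod R 1.
    by rewrite -rE; apply/esym/to_group_modP; rewrite invg1 mul1g => N [_]; exact.
  by rewrite (morph_R (@to_group_modM _ R)).
exists (F' \o psi); split=> [x y|s] /=; last first.
  by rewrite -phi_gen phiK F'E FE.
by rewrite -F'M; congr F'; apply: (can_inj phiK); rewrite gmulfM !psiK.
Qed.

Lemma RAAG_ind (P : G -> Prop) : P 1 ->
  (forall s x, S s -> P x -> P (s * x)) -> (forall s x, S s -> P x -> P (s^-1 * x)) ->
  forall x, P x.
Proof.
case: RAAG => R [_ [phi [[psi phiK psiK] phi_gen]]] P1 PM PV x.
rewrite -[x]psiK -[psi x]to_group_mod_repr.
elim/free_group_ind: (repr (psi x)) => [|s y IH|s y IH].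
- by rewrite [phi _](morph_1 (@gmulfM _ _ phi)).
- rewrite to_group_modM gmulfM /= [phi (_ _)]phi_gen.
  by apply: PM => //; exact: set_valP.
- rewrite to_group_modM gmulfM (morph_V (@to_group_modM _ R)).
  rewrite (morph_V (@gmulfM _ _ phi)) [phi (_ _)]phi_gen.
  by apply: PV => //; exact: set_valP.
Qed.

End RAAG.

(** * Finite generating sets, integral powers and separating functionals *)

(** For a generator s, some morphism to a group of order two is nontrivial at s
    and trivial at all other generators.  It kills every element that can be
    written without s; so each generator occurs in the words chosen for a finite
    set that generates G. *)
Lemma RAAG_finite (G : groupType) (S : set G) :
  RAAG_generating_set S -> finitely_generated G -> finite_set S.
Proof.
move=> RAAG [A [/finite_seqP[as_ AE] Agen]].
(* The matrix -1 of size one serves as the element of order two. *)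
have m1_unit : (- 1%:M : 'M[int]_1)%R \in unitmx by rewrite unitmxE det_mx11 !mxE.
pose m1 : GLint 1 := Sub (- 1%:M)%R m1_unit.
(* This follows from x being a word in the generators that r contains, and it
   avoids talking about words. *)
pose killed (r : seq G) x := forall F : G -> GLint 1,
  {morph F : y z / y * z} -> (forall s, S s -> s \in r -> F s = 1) -> F x = 1.
have killed_by x : exists r, killed r x.
  elim/(RAAG_ind RAAG): x => [|s x Ss [r rx]|s x Ss [r rx]].
  - by exists [::] => F FM _; exact: morph_1.
  - exists (s :: r) => F FM Fr; rewrite FM Fr ?mem_head // mul1g.
    by apply: rx => // t St tr; apply: Fr; rewrite // in_cons tr orbT.
  - exists (s :: r) => F FM Fr; rewrite FM morph_V // Fr ?mem_head // invg1 mul1g.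
    by apply: rx => // t St tr; apply: Fr; rewrite // in_cons tr orbT.
have [r rA] : exists r, forall x, x \in as_ -> killed r x.
  elim: as_ {AE} => [|x s [r rs]]; first by exists [::].
  have [r' r'x] := killed_by x; exists (r' ++ r) => y.
  rewrite in_cons => /orP[/eqP->|ys] F FM Fr.
    by apply: r'x => // t St tr; apply: Fr; rewrite // mem_cat tr.
  by apply: (rs y ys) => // t St tr; apply: Fr; rewrite // mem_cat tr orbT.
apply: (sub_finite_set (B := [set` r])); last exact: finite_seq.
move=> s Ss /=; apply: contrapT => /negP sr.
pose f (t : S) := if val t == s then m1 else 1.
have [|F [FM FE]] := RAAG_morph RAAG (f := f).
  move=> t u _; rewrite /f; case: ifP => _; case: ifP => _ //.
  - exact: commute1.
  - exact/commute_sym/commute1.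
have Fker x : F x = 1.
  have: generated A x by rewrite Agen.
  move=> /(_ [set y | F y = 1]); apply; split.
    split=> [|y z]; rewrite !inE /=; first exact: morph_1.
    by move=> Fy Fz; rewrite FM morph_V // Fy Fz mulgV.
  move=> y; rewrite AE /= => /rA; apply=> // t St tr.
  have := FE (SigSub (mem_set St)); rewrite /f /= => ->.
  by case: eqP tr sr => // -> ->.
have /(congr1 val)/matrixP/(_ 0 0)%R : m1 = 1.
  by rewrite -(Fker s); have := FE (SigSub (mem_set Ss)); rewrite /f /= eqxx => ->.
by rewrite !mxE.
Qed.

Definition zexp (G : groupType) (x : G) (c : int) : G :=
  match c with Posz n => x ^+ n | Negz n => x ^- n.+1 end.

Lemma zexp_unique (G : groupType) (h : int -> G) :
  (forall a b, h (a + b)%R = h a * h b) -> forall c, h c = zexp (h 1%R) c.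
Proof.
move=> hD; have h0 : h 0%R = 1 by apply: (mulgI (h 0%R)); rewrite -hD mulg1.
have hn n : h (Posz n) = h 1%R ^+ n.
  by elim: n => [|n IH]; rewrite ?expg0 // intS hD IH expgS.
case=> n; first exact: hn.
by apply: (mulgI (h (Posz n.+1))); rewrite -hD NegzE addrN h0 [h (Posz n.+1)]hn mulgV.
Qed.

Lemma zexpD (G : groupType) (x : G) a b : zexp x (a + b)%R = zexp x a * zexp x b.
Proof.
have SR c : zexp x (c + 1)%R = zexp x c * x.
  case: c => [n|[|n]]; first by rewrite -PoszD addn1 /= expgSr.
    by rewrite NegzE addNr /= expg1 mulVg.
  have -> : (Negz n.+1 + 1)%R = Negz n by lia.
  by rewrite /= [in RHS]expgS invgM mulgVK.
have SL c : zexp x (c - 1)%R = zexp x c * x^-1.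
  by rewrite -{2}(subrK 1%R c) SR mulgK.
elim/int_ind: b => [|n IH|n IH]; first by rewrite addr0 mulg1.
  by rewrite intS [(1 + _)%R]addrC addrA SR IH SR mulgA.
by rewrite intS opprD [(-1 + _)%R]addrC addrA SL IH SL mulgA.
Qed.

Lemma commute_zexp (G : groupType) (x y : G) c : commute x y -> commute x (zexp y c).
Proof. by case: c => n xy; rewrite /=; [|apply: commuteV]; exact: commuteX. Qed.

Section Functionals.
Local Open Scope ring_scope.

Lemma trivial_exp_tors (N : nat) (c : int) : (1 < N)%N ->
  trivial_exp N true c = (N%:Z %| c)%Z.
Proof.
move=> N1; rewrite /trivial_exp dvdzE /=.
have -> : (c%:~R == 0 :> 'Z_N) = ((`|c|%N)%:R == 0 :> 'Z_N).
  by case: c => n //=; rewrite NegzE mulrNz oppr_eq0.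
by rewrite -(inj_eq val_inj) /= val_Zp_nat.
Qed.

(** In the basis given by the Smith normal form, a is d times a basis vector up
    to sign, so membership in <a> is read off coordinate by coordinate. *)
Lemma cyclic_quotient n (a : 'rV[int]_n) :
  exists (d : int) (R : 'M[int]_n),
    (forall c : 'I_n,
       if c == 0%N :> nat then (d %| (a *m R) 0%R c)%Z else (a *m R) 0 c == 0) /\
    forall g : 'rV[int]_n,
      (forall c : 'I_n,
       if c == 0%N :> nat then (d %| (g *m R) 0%R c)%Z else (g *m R) 0 c == 0) ->
      exists z : int, g = a *~ z.
Proof.
have [L uL [R uR [d _ aE]]] := int_Smith_normal_form a.
have aR c : (a *m invmx R) 0 c = L 0 0 * (d`_0 *+ (0 == c :> nat)).
  by rewrite aE mulmxK // !mxE big_ord1 !mxE.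
exists d`_0, (invmx R); split=> [c|g gR].
  by rewrite aR eq_sym; case: eqP => _; rewrite ?mulr0 // dvdz_mull.
have LV : invmx L 0 0 * L 0 0 = 1.
  by have /matrixP/(_ 0 0) := mulVmx uL; rewrite !mxE big_ord1.
have [q qE] : exists q, forall c, (g *m invmx R) 0 c = q * (d`_0 *+ (0 == c :> nat)).
  case: n => [|n] in a R g uR aE aR gR *; first by exists 0 => -[].
  have /dvdzP[q qE] := gR 0; exists q => c.
  by have := gR c; rewrite eq_sym; case: eqP => [c0 _|_ /eqP->]; rewrite ?mulr0 // mulr1n -qE;
    congr (_ _ _); apply: val_inj.
exists (q * invmx L 0 0); apply: (can_inj (mulmxK (_ : invmx R \in unitmx))).
  by rewrite unitmx_inv.
apply/rowP=> c; rewrite -scaler_int intz -scalemxAl [RHS]mxE aR qE.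
by rewrite mulrA -[q * _ * L 0 0]mulrA LV mulr1.
Qed.

(** One family of functionals separates A from 0, by the coordinates, and each
    A / <a i> from 0, by the coordinates of cyclic_quotient. *)
Lemma separating_functionals m n (a : 'I_m -> 'rV[int]_n) :
  exists (X : finType) (N : nat) (tors : pred X) (lam : X -> 'rV[int]_n -> int),
    [/\ forall x g h, lam x (g + h) = lam x g + lam x h,
        forall g, (forall x, trivial_exp N (tors x) (lam x g)) -> g = 0
      & forall i g,
          (forall x, trivial_exp N (tors x) (lam x (a i)) ->
                     trivial_exp N (tors x) (lam x g)) ->
          exists z : int, g = a i *~ z].
Proof.
have {}/choice[d /choice[R dR]] := fun i => cyclic_quotient (a i).
pose D i : nat := if d i == 0 then 1%N else `|d i|%N.
have D_gt0 i : (0 < D i)%N by rewrite /D; case: eqP => // /eqP; rewrite absz_gt0.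
(* A functional modulo d i becomes a functional modulo the common multiple N
   after rescaling by N / d i.  The factor 2 ensures 1 < N, since 'Z_N is Z/2
   for smaller N. *)
pose N : nat := (2 * \prod_i D i)%N.
have N1 : (1 < N)%N.
  by rewrite /N -[1%N]/(2 * 1).-1 prednK // leq_pmul2l // prodn_gt0.
pose M i : int := (N%:Z %/ d i)%Z.
have MN i : d i != 0 -> N%:Z = M i * d i.
  move=> di; rewrite /M divzK // /N (bigD1 i) //= /D (negPf di) dvdzE /=.
  by rewrite dvdn_mull // dvdn_mulr.
pose tors (x : option 'I_m * 'I_n) :=
  if x.1 is Some i then (x.2 == 0%N :> nat) && (d i != 0) else false.
pose lam (x : option 'I_m * 'I_n) (g : 'rV[int]_n) : int :=
  if x.1 is Some i then (if tors x then M i else 1) * (g *m R i) 0 x.2 else g 0 x.2.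
have triv i c g : trivial_exp N (tors (Some i, c)) (lam (Some i, c) g) =
    if c == 0%N :> nat then (d i %| (g *m R i) 0%R c)%Z else (g *m R i) 0 c == 0.
  rewrite /lam /tors /=; case: eqP => [_|_] /=; last by rewrite mul1r.
  case: eqVneq => [->|di] /=; first by rewrite mul1r dvd0z.
  rewrite -[LHS]/(trivial_exp N true _) trivial_exp_tors // (MN i) // dvdz_mul2l //.
  by apply: contraTneq N1 => M0; have := MN i di; rewrite M0 mul0r => -[->].
exists (option 'I_m * 'I_n)%type, N, tors, lam; split.
- move=> [[i|] c] g h; rewrite /lam /=; last by rewrite mxE.
  by rewrite mulmxDl [X in _ * X = _]mxE mulrDr.
- move=> g g0; apply/rowP=> c; rewrite mxE; apply/eqP; exact: (g0 (None, c)).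
- move=> i g ag; apply: (dR i).2 => c.
  have := ag (Some i, c); rewrite !triv; have := (dR i).1 c.
  by move=> ai; apply.
Qed.

End Functionals.

(** * The fundamental group of a star of groups *)

Section StarGroup.
Variables (m : nat) (GG : star_of_groups m).
Local Notation G := (fundamental_group GG).

Definition vertex_incl (v : option 'I_m) (x : vertex_group GG v) : G :=
  to_group_mod (@edge_relators m GG) (@free_product_incl _ (vertex_group GG) v x).

Lemma vertex_inclM v : {morph @vertex_incl v : x y / x * y}.
Proof. by move=> x y; rewrite /vertex_incl free_product_inclM to_group_modM. Qed.

Lemma vertex_incl_edge i (g : edge_group GG i) :
  @vertex_incl None (alpha GG i g) = @vertex_incl (Some i) (omega GG i g).
Proof.
apply/esym/to_group_modP.
set e := free_product_incl _; set c := free_product_incl _.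
have /(normal_closureJ e) : normal_closure (@edge_relators m GG) (c / e).
  by move=> N [_ RN]; apply: RN; exists i, g.
by rewrite /conjg mulgVK.
Qed.

Lemma fundamental_group_ind (P : G -> Prop) : P 1 ->
  (forall v (x : vertex_group GG v) y, P y -> P (vertex_incl x * y)) -> forall y, P y.
Proof.
move=> P1 PM y; rewrite -[y]to_group_mod_repr.
elim/free_product_ind: (repr y) => [//|v x z Pz].
by rewrite to_group_modM; exact: PM.
Qed.

Lemma fundamental_group_morph (H : groupType)
    (f : forall v, vertex_group GG v -> H) :
    (forall v, {morph f v : x y / x * y}) ->
    (forall i g, f None (alpha GG i g) = f (Some i) (omega GG i g)) ->
  exists F : G -> H, {morph F : x y / x * y} /\
    forall v (x : vertex_group GG v), F (vertex_incl x) = f v x.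
Proof.
move=> fM f_edge; have [F [FM FE]] := free_product_morph fM.
have [|F' [F'M F'E]] := group_mod_morph FM (R := @edge_relators m GG).
  move=> r [i [g ->]]; rewrite FM (morph_V FM).
  rewrite /central_incl /external_incl !FE f_edge; exact: mulgV.
by exists F'; split=> // v x; rewrite F'E FE.
Qed.

End StarGroup.

(** * Linearity *)

Theorem corollary4p2 (m : nat) (GG : star_of_groups m)
    (central_free_abelian : free_abelian_of_finite_rank (central_group GG))
    (S : forall i : 'I_m, set (external_group GG i))
    (external_RAAG : forall i : 'I_m, RAAG_generating_set (S i))
    (external_fg : forall i : 'I_m, finitely_generated (external_group GG i))
    (k : forall i : 'I_m, edge_group GG i)
    (edge_cyclic : forall i : 'I_m, generated [set k i] = [set: edge_group GG i])
    (omega_k : forall i : 'I_m,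
       S i (omega GG i (k i)) \/
       exists S' : set (external_group GG i),
         RAAG_generating_set S' /\ S' (omega GG i (k i))) :
  Z_linear (fundamental_group GG).
Proof.
have [n [f [[f' fK f'K] fM]]] := central_free_abelian.
pose s i := omega GG i (k i).
have exT i : exists T : set (external_group GG i), RAAG_generating_set T /\ T (s i).
  by case: (omega_k i) => [Si|[S' S'i]]; [exists (S i) | exists S'].
pose T i := sval (cid (exT i)).
have RT i : RAAG_generating_set (T i) := (svalP (cid (exT i))).1.
have Ts i : T i (s i) := (svalP (cid (exT i))).2.
have ex_ts i : exists ts : seq (external_group GG i),
    forall x, x \in ts <-> T i x /\ x != s i.
  have /finite_seqP[ts tsE] := RAAG_finite (RT i) (external_fg i).
  exists [seq x <- ts | x != s i] => x; rewrite mem_filter tsE /=.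
  by split=> [/andP[]|[-> ->]].
pose ts i := sval (cid (ex_ts i)).
have tsP i x : x \in ts i <-> T i x /\ x != s i := svalP (cid (ex_ts i)) x.
pose a i := f (alpha GG i (k i)).
have [X [N [tors [lam [lamD lam_sep lam_cyc]]]]] := separating_functionals a.
pose gens : finType := {i : 'I_m & seq_sub (ts i)}.
pose iota (g : 'rV[int]_n) := @vertex_incl _ GG None (f' g).
have iotaD g h : iota (g + h)%R = iota g * iota h.
  rewrite -vertex_inclM; congr (vertex_incl _); apply: (can_inj fK).
  by rewrite fM !f'K.
have iota0 : iota 0%R = 1.
  by apply: (mulgI (iota 0%R)); rewrite -iotaD addr0 mulg1.
have iota_f x : iota (f x) = @vertex_incl _ GG None x by rewrite /iota fK.
have iota_a i : iota (a i) = @vertex_incl _ GG (Some i) (s i).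
  by rewrite iota_f vertex_incl_edge.
pose tau (x : gens) := @vertex_incl _ GG (Some (tag x)) (ssval (tagged x)).
pose syl x c := zexp (tau x) c.
pose triv x g := trivial_exp N (tors x) (lam x g).
(* The graph is read off G itself: joined means commuting there, so the
   compatibility of the graph with the relations of G is immediate. *)
pose E : rel gens := fun x y =>
  [&& tag x == tag y, x != y & `[< commute (tau x) (tau y) >]].
pose J (x : gens) : pred X := fun v =>
  `[< commute (tau x) (iota (a (tag x))) >] && ~~ triv v (a (tag x)).
have E_sym : symmetric E.
  move=> x y; rewrite /E eq_sym [x == y]eq_sym; congr [&& _, _ & _].
  by apply: asbool_equiv_eq; split=> /commute_sym.
have E_irr : irreflexive E by move=> x; rewrite /E !eqxx.
have E_commute x y c c' : E x y -> commute (syl x c) (syl y c').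
  case/and3P => _ _ /asboolP xy; apply/commute_zexp/commute_sym.
  exact/commute_zexp/commute_sym.
have J_nested x y : E x y -> {subset J x <= J y} \/ {subset J y <= J x}.
  case/and3P => /eqP xy _ _.
  have [cx|ncx] := pselect (commute (tau x) (iota (a (tag x)))); last first.
    by left=> v /andP[/asboolP].
  by right=> v /andP[_ va]; apply/andP; split; [exact/asboolP | rewrite xy].
(* If x commutes with a_i, then g vanishes wherever a_i does, hence is a multiple
   of a_i; if not, x is joined to no functional and g = 0. *)
have iota_commute g x c : (forall v, ~~ triv v g -> J x v) ->
    commute (iota g) (syl x c).
  move=> gJ; apply: commute_zexp.
  have [cx|ncx] := pselect (commute (tau x) (iota (a (tag x)))); last first.
    rewrite [g]lam_sep => [|v]; last first.
      by apply/negPn/negP => /gJ/andP[/asboolP].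
    by rewrite iota0; exact/commute_sym/commute1.
  have [v av|z ->] := lam_cyc (tag x) g.
    by apply/negPn/negP => /gJ/andP[_]; rewrite /triv av.
  rewrite (zexp_unique (h := fun z => iota (a (tag x) *~ z)%R)).
    by apply/commute_sym/commute_zexp; rewrite mulr1z.
  by move=> z1 z2; rewrite mulrzDr iotaD.
pose adj := adjacent J E.
pose elt := vertex_elt N adj (torsion tors).
pose cent := central_elt N lam tors J E.
have adj_sym : symmetric adj by exact: adjacent_sym.
have adj_irr : irreflexive adj by exact: adjacent_irr.
have elt_cent x : commute (tau x) (iota (a (tag x))) ->
    commute (elt (inr x) 1%R) (cent (a (tag x))).
  move=> cx; apply: central_on_commute => v _.
  have [va|va] := boolP (triv v (a (tag x))).
    by rewrite [X in commute _ X]vertex_elt_trivial //; exact: commute1.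
  apply: vertex_elt_comm => //=.
  by apply/andP; split=> //; apply/asboolP.
have elt_elt x y : tag x = tag y -> commute (tau x) (tau y) ->
    commute (elt (inr x) 1%R) (elt (inr y) 1%R).
  move=> xy cxy; have [->|nxy] := eqVneq x y; first exact: commute_refl.
  apply: vertex_elt_comm => //=; apply/and3P; split=> //; first exact/eqP.
  exact/asboolP.
(* The generator s_i goes to the image of a_i, as the edge relation forces. *)
pose fi i (t : T i) := if val t == s i then cent (a i) else
  if insub (val t) : option (seq_sub (ts i)) is Some x
  then elt (inr (Tagged (fun i => seq_sub (ts i)) x)) 1%R else 1.
have T_case i (t : T i) : val t = s i /\ fi i t = cent (a i) \/
    exists x : seq_sub (ts i), ssval x = val t /\
      fi i t = elt (inr (Tagged (fun i => seq_sub (ts i)) x)) 1%R.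
  have [ti|nti] := eqVneq (val t) (s i); first by left; rewrite /fi ti eqxx.
  have tts : val t \in ts i by apply/tsP; split=> //; exact: set_valP.
  right; exists (SeqSub tts); split=> //.
  by rewrite /fi (negPf nti) insubT.
have fi_commute i (t u : T i) : commute (val t) (val u) -> commute (fi i t) (fi i u).
  move=> tu; have vtu : commute (@vertex_incl _ GG (Some i) (val t))
                             (@vertex_incl _ GG (Some i) (val u)).
    by rewrite /commute -!vertex_inclM tu.
  case: (T_case i t) (T_case i u) => [[ti ->]|[x [xt ->]]] [[ui ->]|[y [yu ->]]].
  - exact: commute_refl.
  - by apply/commute_sym/elt_cent; rewrite iota_a /tau /= yu -ti; exact/commute_sym.
  - by apply/elt_cent; rewrite iota_a /tau /= xt -ui.
  - by apply: elt_elt; rewrite // /tau /= xt yu.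
pose F i := sval (cid (RAAG_morph (RT i) (@fi_commute i))).
have FM i : {morph F i : x y / x * y} := (svalP (cid (RAAG_morph (RT i) (@fi_commute i)))).1.
have FE i t : F i (val t) = fi i t := (svalP (cid (RAAG_morph (RT i) (@fi_commute i)))).2 t.
pose phi v : vertex_group GG v -> GLint _ :=
  match v with None => fun x => cent (f x) | Some i => F i end.
have phiM v : {morph phi v : x y / x * y}.
  case: v => [i|] x y /=; first exact: FM.
  by rewrite fM [LHS]central_eltD.
have phi_edge i g : phi None (alpha GG i g) = phi (Some i) (omega GG i g).
  have: generated [set k i] g by rewrite edge_cyclic.
  move=> /(_ [set g | phi None (alpha GG i g) = phi (Some i) (omega GG i g)]); apply.
  pose l := phi None \o alpha GG i; pose r := phi (Some i) \o omega GG i.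
  have lM : {morph l : x y / x * y} by move=> x y; rewrite /l /= gmulfM [LHS](phiM None).
  have rM : {morph r : x y / x * y} by move=> x y; rewrite /r /= gmulfM [LHS](phiM (Some i)).
  split=> [|_ ->] /=.
    split=> [|x y]; rewrite !inE; first by rewrite /= [LHS](morph_1 lM) [RHS](morph_1 rM).
    move=> xE yE; rewrite /= [LHS](lM x y^-1) [RHS](rM x y^-1).
    by rewrite (morph_V lM) (morph_V rM); congr (_ * _^-1).
  rewrite -/(s i); have := FE i (SigSub (mem_set (Ts i))); rewrite /= => ->.
  by rewrite /fi /= eqxx.
have [Phi [PhiM PhiE]] := fundamental_group_morph phiM phi_edge.
have Phi_tau x : Phi (tau x) = elt (inr x) 1%R.
  case: x => i x; have [Tx nx] := (tsP i (ssval x)).1 (ssvalP x).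
  rewrite /tau PhiE /= [LHS](FE i (SigSub (mem_set Tx))).
  have [[/= xs]|[x' [/= x'x ->]]] := T_case i (SigSub (mem_set Tx)).
    by rewrite xs eqxx in nx.
  by rewrite (val_inj x'x : x' = x).
have sylD x c c' : syl x (c + c')%R = syl x c * syl x c' by exact: zexpD.
have Phi_syl x c : Phi (syl x c) = elt (inr x) c.
  rewrite (zexp_unique (h := fun c => Phi (syl x c))) => [|c1 c2]; last first.
    by rewrite sylD PhiM.
  rewrite [RHS](zexp_unique (h := fun c => elt (inr x) c)) => [|c1 c2]; last first.
    exact: vertex_eltD.
  by rewrite -Phi_tau /syl /= expg1.
have Phi_iota g : Phi (iota g) = cent g by rewrite /iota PhiE /= f'K.
have generation (P : fundamental_group GG -> Prop) : P 1 ->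
    (forall g y, P y -> P (iota g * y)) ->
    (forall x c y, P y -> P (syl x c * y)) -> forall y, P y.
  move=> P1 Piota Psyl; apply: fundamental_group_ind => // -[i|] x y Py; last first.
    by rewrite -iota_f; exact: Piota.
  pose inc := @vertex_incl _ GG (Some i).
  (* A generator and its inverse are the values at 1 and -1 of a family that
   induction covers: the multiples of a_i for s_i, the powers for the others. *)
  suff gen t : T i t -> exists p : int -> fundamental_group GG,
      [/\ inc t = p 1%R, inc t^-1 = p (- 1)%R & forall c z, P z -> P (p c * z)].
    move: y Py; elim/(RAAG_ind (RT i)): x => [|t x Tt IH|t x Tt IH] y Py.
    - by rewrite [vertex_incl _](morph_1 (@vertex_inclM _ GG (Some i))) mul1g.
    - rewrite vertex_inclM -mulgA -/(inc t); have [p [-> _ pP]] := gen t Tt.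
      exact/pP/IH.
    - rewrite vertex_inclM -mulgA -/(inc t^-1); have [p [_ -> pP]] := gen t Tt.
      exact/pP/IH.
  move=> Tt; have incV : inc t^-1 = (inc t)^-1 by exact: (morph_V (@vertex_inclM _ GG (Some i))).
  have [ts_|nts] := eqVneq t (s i).
    exists (fun c => iota (a i *~ c)%R); split=> [||c z]; last exact: Piota.
      by rewrite mulr1z iota_a ts_.
    rewrite incV ts_ /inc -iota_a; apply: (mulgI (iota (a i))).
    by rewrite mulgV -iotaD mulrNz mulr1z addrN iota0.
  have tts : t \in ts i by apply/tsP.
  pose x0 : gens := Tagged (fun i => seq_sub (ts i)) (SeqSub tts).
  exists (syl x0); split=> [||c z]; last exact: Psyl.
    by rewrite /syl /= expg1.
  by rewrite incV /syl /= expg1.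
apply: (Z_linear_GLint PhiM) => y.
exact: (Phi_faithful iotaD sylD E_sym E_irr PhiM Phi_iota Phi_syl E_commute J_nested
  iota_commute lam_sep generation).
Qed.
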